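(* Let $X$ be a real Banach space, $f:X\to\,]-\infty,+\infty]$ a proper lower semicontinuous function, $\bar x\in\operatorname{dom} f$ and $u\in X$, $u\neq 0$. Let $\partial$ be an arbitrary subdifferential on $X$ (in the sense defined in the context). (a) Assume $f$ is radially accessible at $\bar x$ from $u$. Then $f$ is upper semismooth at $\bar x$ in the direction $u$ if and only if $$f^r(\bar x;u)=\inf_{\alpha\ge 0}\ \limsup_{x\to_u\bar x} f^{\partial}(x;u+\alpha(\bar x-x)).$$ (b) $f$ is strictly upper semismooth at $\bar x$ in the direction $u$ if and only if $$f^r(\bar x;u)=\inf_{\alpha\ge 0}\ \limsup_{x\to\bar x} f^{\partial}(x;u+\alpha(\bar x-x)).$$
   Context: $X$ is a real Banach space, $X^*$ its topological dual, $\langle\cdot,\cdot\rangle$ the duality pairing. For $f:X\to\,]-\infty,+\infty]$, $\operatorname{dom} f=\{x: f(x)<+\infty\}$; $f$ is proper if $\operatorname{dom} f\ne\emptyset$; lsc means lower semicontinuous. Subderivatives: for lsc $f$, $x\in\operatorname{dom} f$, $u\in X$, $$f^r(x;u)=\liminf_{t\searrow0}\frac{f(x+tu)-f(x)}{t},\qquad f^\uparrow(x;u)=\sup_{\delta>0}\ \limsup_{t\searrow 0,\ (y,f(y))\to(x,f(x))}\ \inf_{u'\in B_\delta(u)}\frac{f(y+tu')-f(y)}{t},$$ with values in $[-\infty,+\infty]$, where $B_\delta(u)$ is the ball of center $u$ and radius $\delta$. Subdifferentials: for $x\in\operatorname{dom} f$ let $\partial_{MR}f(x)=\{x^*\in X^*:\langle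 x^*,y-x\rangle+f(x)\le f(y)\ \forall y\in X\}$ and $\partial_C f(x)=\{x^*\in X^*:\langle x^*,v\rangle\le f^\uparrow(x;v)\ \forall v\in X\}$; all subdifferentials are empty at points outside $\operatorname{dom} f$. A subdifferential on $X$ is any operator $\partial$ that associates to each proper lsc $f:X\to\,]-\infty,+\infty]$ a set-valued mapping $\partial f:X\rightrightarrows X^*$ (identified with its graph in $X\times X^*$) such that $\partial_{MR}f(x)\subset\partial f(x)\subset\partial_Cf(x)$ for all $x$ and the following Separation Principle holds: for any lsc $f,\varphi$ with $\varphi$ convex Lipschitz near $\bar x\in\operatorname{dom} f$, if $f+\varphi$ has a local minimum at $\bar x$, then $0\in\widehat\partial f(\bar x)+\partial\varphi(\bar x)$, where $\widehat\partial f(\bar x)$ is the set of $\bar x^*\in X^*$ for which there is a net $((x_\nu,x_\nu^* ))_\nu\subset\partial f$ with $(x_\nu,f(x_\nu))\to(\bar x,f(\bar x))$, $x_\nu^*\to\bar x^*$ in the weak-star topology, and $\limsup_\nu\langle x^*_\nu,x_\nu-\bar x\rangle\le0$. The subderivative associated to $\partial f$ is $f^\partial(x;u)=\sup\{\langle x^*,u\rangle: x^*\in\partial f(x)\}$ for $x\in\operatorname{dom} f$ (with $\sup\emptyset=-\infty$). Directional convergence: $x_n\to_v\bar x$ means there are $t_n>0$, $t_n\to0$, and $v_n\to v$ with $x_n=\bar x+t_nv_n$ for all $n$ (for $v=0$ this is just $x_n\to\bar x$, and $x_n=\bar x$ is allowed). $\limsup_{x\to_v\bar x}F(x)$, for $F$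 defined on $\operatorname{dom} f$, is the supremum of $\limsup_nF(x_n)$ over all sequences $x_n\to_v\bar x$ in $\operatorname{dom} f$ ($-\infty$ if there are none); $\limsup_{x\to\bar x}$ is the case $v=0$. $f$ is radially accessible at $\bar x\in\operatorname{dom} f$ from $u$ if $f(\bar x)=\liminf_{t\searrow0}f(\bar x+tu)$. $f$ is upper semismooth at $\bar x\in\operatorname{dom} f$ in the direction $u$ if $\inf_{\alpha\ge0}\limsup_{x\to_u\bar x}f^r(x;u+\alpha(\bar x-x))\le f^r(\bar x;u)$; it is strictly upper semismooth at $\bar x$ in the direction $u$ if $\inf_{\alpha\ge0}\limsup_{x\to\bar x}f^r(x;u+\alpha(\bar x-x))\le f^r(\bar x;u)$. *)

(* Defs.v *)
From HB Require Import structures.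
From mathcomp Require Import all_boot all_order all_algebra.
From mathcomp Require Import all_classical all_reals all_analysis.

Set Implicit Arguments.
Unset Strict Implicit.
Unset Printing Implicit Defensive.

Import Order.TTheory GRing.Theory Num.Theory.
Import numFieldNormedType.Exports.

Local Open Scope classical_set_scope.
Local Open Scope ring_scope.
Local Open Scope ereal_scope.

Definition edom (R : realType) (X : Type) (f : X -> \bar R) : set X :=
  [set x | f x < +oo].

(* Functions into ]-oo, +oo] are functions f : X -> \bar R with ninfty_free f. *)
Definition ninfty_free (R : realType) (X : Type) (f : X -> \bar R) : Prop :=
  forall x, f x != -oo.

Definition proper_efun (R : realType) (X : Type) (f : X -> \bar R) : Prop :=
  ninfty_free f /\ edom f !=set0.

(* On functions that avoid -oo every right-hand side is well defined; at
   t = 0 or t = 1 the convention 0 * +oo = 0 makes the inequality trivial. *)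
Definition convex_efun (R : realType) (X : lmodType R) (phi : X -> \bar R) :=
  forall (x y : X) (t : R), (0 <= t <= 1)%R ->
    phi (t *: x + (1 - t) *: y)%R <= t%:E * phi x + (1 - t)%:E * phi y.

Definition lipschitz_near (R : realType) (X : normedModType R)
    (phi : X -> \bar R) (a : X) : Prop :=
  exists2 V, nbhs a V &
    (forall y, V y -> phi y \is a fin_num) /\
    [lipschitz (fine (phi y) : R^o) | y in V].

Definition local_min (R : realType) (X : topologicalType)
    (g : X -> \bar R) (a : X) : Prop :=
  \forall y \near a, g a <= g y.

Definition diffquot (R : realType) (X : lmodType R) (f : X -> \bar R)
    (x u : X) (t : R) : \bar R :=
  (f (x + t *: u)%R - f x) * (t^-1)%:E.

Definition radial_subderiv (R : realType) (X : normedModType R)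
    (f : X -> \bar R) (x u : X) : \bar R :=
  limf_einf (diffquot f x u) (0%R : R)^'+.

(* Neighbourhoods of x for the convergence (y, f y) --> (x, f x); since f x is
   finite for x in edom f, small such neighbourhoods are contained in edom f. *)
Definition graph_nbhs (R : realType) (X : normedModType R)
    (f : X -> \bar R) (x : X) : set_system X :=
  filter_from (nbhs (x, f x)) (fun W => [set y | W (y, f y)]).

Definition upper_subderiv (R : realType) (X : normedModType R)
    (f : X -> \bar R) (x u : X) : \bar R :=
  ereal_sup [set
    limf_esup
      (fun p : R * X => ereal_inf [set diffquot f p.2 u' p.1 | u' in ball u d])
      (filter_prod (0%R : R)^'+ (graph_nbhs f x))
  | d in [set d : R | (0 < d)%R]].

Record dual (R : realType) (X : normedModType R) := Dual {
  dual_fun :> {linear X -> R^o};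
  dual_continuous : continuous dual_fun }.

Definition pairing (R : realType) (X : normedModType R) (l : dual X) (v : X) : R :=
  l v.

Definition subdiff_MR (R : realType) (X : normedModType R)
    (f : X -> \bar R) (x : X) : set (dual X) :=
  [set l | edom f x /\ forall y, (pairing l (y - x)%R)%:E + f x <= f y].

Definition subdiff_C (R : realType) (X : normedModType R)
    (f : X -> \bar R) (x : X) : set (dual X) :=
  [set l | edom f x /\ forall v, (pairing l v)%:E <= upper_subderiv f x v].

Definition directed (I : Type) (le : I -> I -> Prop) : Prop :=
  [/\ inhabited I,
      (forall i, le i i),
      (forall i j k, le i j -> le j k -> le i k) &
      (forall i j, exists k, le i k /\ le j k)].

Definition net_tails (I : Type) (le : I -> I -> Prop) : set_system I :=
  filter_from setT (fun i => [set j | le i j]).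

Definition net_limsup (R : realType) (I : Type) (le : I -> I -> Prop)
    (a : I -> \bar R) : \bar R :=
  ereal_inf [set ereal_sup [set a j | j in [set j | le i j]] | i in setT].

Definition subdiff_op (R : realType) (X : normedModType R) : Type :=
  (X -> \bar R) -> X -> set (dual X).

(* Weak-star convergence of the net l is spelled out as pointwise convergence
   on X. *)
Definition subdiff_hat (R : realType) (X : normedModType R)
    (D : subdiff_op X) (f : X -> \bar R) (xbar : X) : set (dual X) :=
  [set lbar | exists (I : Type) (le : I -> I -> Prop) (x : I -> X) (l : I -> dual X),
    [/\ directed le,
        (forall i, D f (x i) (l i)),
        (fun i => (x i, f (x i))) @ net_tails le --> (xbar, f xbar),
        (forall v : X,
           (fun i => pairing (l i) v) @ net_tails le --> pairing lbar v) &
        net_limsup le (fun i => (pairing (l i) (x i - xbar)%R)%:E) <= 0]].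

(* The last conclusion is 0 \in subdiff_hat D f xbar + D phi xbar. *)
Definition separation_principle (R : realType) (X : normedModType R)
    (D : subdiff_op X) : Prop :=
  forall (f phi : X -> \bar R) (xbar : X),
    ninfty_free f -> lower_semicontinuous f ->
    ninfty_free phi -> lower_semicontinuous phi ->
    convex_efun phi -> lipschitz_near phi xbar ->
    edom f xbar ->
    local_min (fun y => f y + phi y) xbar ->
    exists l m : dual X,
      [/\ subdiff_hat D f xbar l, D phi xbar m &
          forall v : X, (pairing l v + pairing m v = 0)%R].

(* A subdifferential is defined on proper lsc functions only; the values of D
   at other functions are unconstrained and never used. *)
Definition is_subdifferential (R : realType) (X : normedModType R)
    (D : subdiff_op X) : Prop :=
  (forall f : X -> \bar R, proper_efun f -> lower_semicontinuous f ->
     forall x : X, subdiff_MR f x `<=` D f x /\ D f x `<=` subdiff_C f x) /\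
  separation_principle D.

(* ereal_sup set0 = -oo, so this is -oo where D f x is empty. *)
Definition subdiff_subderiv (R : realType) (X : normedModType R)
    (D : subdiff_op X) (f : X -> \bar R) (x u : X) : \bar R :=
  ereal_sup [set (pairing l u)%:E | l in D f x].

(* For v = 0 this is ordinary convergence of x to a: the steps t can be chosen
   so that (x n - a) / t n still tends to 0. *)
Definition dir_cvg (R : realType) (X : normedModType R)
    (v a : X) (x : nat -> X) : Prop :=
  exists (t : nat -> R) (w : nat -> X),
    [/\ (forall n, (0 < t n)%R),
        t @ \oo --> (0%R : R),
        w @ \oo --> v &
        forall n, x n = (a + t n *: w n)%R].

Definition dir_limsup (R : realType) (X : normedModType R)
    (f : X -> \bar R) (v a : X) (F : X -> \bar R) : \bar R :=
  ereal_sup [set limn_esup (F \o x)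
            | x in [set x : nat -> X | dir_cvg v a x /\ forall n, edom f (x n)]].

Definition inf_dir_limsup (R : realType) (X : normedModType R)
    (f : X -> \bar R) (G : X -> X -> \bar R) (v xbar u : X) : \bar R :=
  ereal_inf [set
    dir_limsup f v xbar (fun x => G x (u + alpha *: (xbar - x))%R)
  | alpha in [set alpha : R | (0 <= alpha)%R]].

Definition radially_accessible (R : realType) (X : normedModType R)
    (f : X -> \bar R) (xbar u : X) : Prop :=
  f xbar = limf_einf (fun t : R => f (xbar + t *: u)%R) (0%R : R)^'+.

Definition upper_semismooth (R : realType) (X : normedModType R)
    (f : X -> \bar R) (xbar u : X) : Prop :=
  inf_dir_limsup f (radial_subderiv f) u xbar u <= radial_subderiv f xbar u.

Definition strictly_upper_semismooth (R : realType) (X : normedModType R)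
    (f : X -> \bar R) (xbar u : X) : Prop :=
  inf_dir_limsup f (radial_subderiv f) 0%R xbar u <= radial_subderiv f xbar u.

(* Main.v *)
(* For [w_x := u + alpha (xbar - x)], the upper limits of [f^r(x; w_x)] and
   [f^D(x; w_x)] along [x -->_v xbar] coincide, for every [v] and every
   [alpha >= 0]; this is local: each value of one subderivative is almost
   attained by the other arbitrarily near.
   - [f^D <= f^up], and [f^up(x; w_x)] is approximated by difference quotients
     on segments from [y] to [y + t w_y], [y] near [x].  At a point of such a
     segment, [w] is a multiple of [w_y], so a one-dimensional mean value
     inequality gives a point where [f^r] is as large.
   - Conversely, if [lambda < f^r(x; v)], Ekeland's principle applied near [x] to
     [f + phi], where [phi y] is the minimum over [s] in [[0, t]] of
     [- lambda s + K |y - x - s v|], gives a point where the Separation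
     Principle yields elements of [D f] of slope almost [lambda].  Indeed
     [y + h (v + alpha (x - y)) - (x + s' v) = (1 - h alpha) (y - (x + s v))] for
     [s' = s + h (1 - alpha s)], so that the penalty does not grow in that
     direction.
   It remains to bound [f^r(xbar; u)] by the limit of [f^r(x; w_x)]: for [v = 0]
   take the constant sequence [xbar], and for [v = u] apply the mean value
   inequality on [[xbar + s u, xbar + t u]], where radial accessibility allows
   [s > 0] with [f (xbar + s u)] close to [f xbar]. *)

Require Import Defs.
From HB Require Import structures.
From mathcomp Require Import all_boot all_order all_algebra ring lra.
From mathcomp Require Import all_classical all_reals all_analysis.

Set Implicit Arguments.
Unset Strict Implicit.
Unset Printing Implicit Defensive.

Import Order.TTheory GRing.Theory Num.Theory.
Import numFieldNormedType.Exports.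
Local Open Scope classical_set_scope.
Local Open Scope ring_scope.

(** * Witnesses for strict bounds on upper and lower limits along a filter *)

Section limf.
Context {R : realType} {T : choiceType} {X : filteredType T}.
Implicit Types (g : X -> \bar R) (F : set_system X) (V : set X) (a : \bar R).

Lemma limf_esup_gt_ex g F V a : (a < limf_esup g F)%E -> F V ->
  exists2 z, V z & (a < g z)%E.
Proof.
move=> ag FV; have : (a < ereal_sup (g @` V))%E.
  by apply: lt_le_trans ag _; apply: ereal_inf_lbound; exists V.
by move=> /ereal_sup_gt[_ [z Vz <-] az]; exists z.
Qed.

Lemma limf_esup_ge_ex g F a :
  (forall V, F V -> exists2 z, V z & (a <= g z)%E) -> (a <= limf_esup g F)%E.
Proof.
move=> ag; apply: le_ereal_inf_tmp => _ [V FV <-].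
have [z Vz az] := ag V FV.
by apply: le_ereal_sup_tmp; exists (g z) => //; exists z.
Qed.

Lemma limf_esup_le g F V a : F V -> (forall z, V z -> (g z <= a)%E) ->
  (limf_esup g F <= a)%E.
Proof.
move=> FV ga; apply: ge_ereal_inf; exists (ereal_sup (g @` V)); first by exists V.
by apply: ge_ereal_sup => _ [z Vz <-]; exact: ga.
Qed.

Lemma limf_einf_ge g F V a : F V -> (forall z, V z -> (a <= g z)%E) ->
  (a <= limf_einf g F)%E.
Proof.
move=> FV ag; rewrite limf_einfE; apply: le_ereal_sup_tmp.
exists (ereal_inf (g @` V)); first by exists V.
by apply: le_ereal_inf_tmp => _ [z Vz <-]; exact: ag.
Qed.

Lemma limf_einf_gt_ex g F a : (a < limf_einf g F)%E ->
  exists2 V, F V & forall z, V z -> (a < g z)%E.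
Proof.
rewrite limf_einfE => /ereal_sup_gt[_ [V FV <-] aV]; exists V => // z Vz.
by apply: lt_le_trans aV _; apply: ereal_inf_lbound; exists z.
Qed.

Lemma limf_einf_lt_ex g F V a : (limf_einf g F < a)%E -> F V ->
  exists2 z, V z & (g z < a)%E.
Proof.
rewrite limf_einfE => ga FV; have : (ereal_inf (g @` V) < a)%E.
  by apply: le_lt_trans ga; apply: ereal_sup_ubound; exists V.
by move=> /ereal_inf_lt[_ [z Vz <-] az]; exists z.
Qed.

End limf.

Lemma edom_fineK {R : realType} {X : Type} {f : X -> \bar R} {x : X} :
  ninfty_free f -> edom f x -> ((fine (f x))%:E = f x)%E.
Proof.
by move=> f_ninfty fx; rewrite fineK// fin_numElt lt_neqAle eq_sym f_ninfty leNye.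
Qed.

Lemma ereal_gt_dense {R : realType} (r : R) (a : \bar R) : (r%:E < a)%E ->
  exists2 r', r < r' & (r'%:E < a)%E.
Proof.
case: a => [a| |//].
  by rewrite lte_fin => ra; exists ((r + a) / 2); rewrite ?lte_fin; lra.
by move=> _; exists (r + 1); rewrite ?ltry//; lra.
Qed.

(** * Difference quotients and a one-dimensional mean value inequality *)

Section subderivatives.
Context {R : realType} {X : normedModType R}.
Variable f : X -> \bar R.
Hypothesis f_ninfty : ninfty_free f.
Implicit Types (x u v w : X) (r s t : R).

Lemma diffquot_ge x u r t : edom f x -> 0 < t ->
  (r%:E <= diffquot f x u t)%E = ((fine (f x) + r * t)%:E <= f (x + t *: u)%R)%E.
Proof.
move=> fx t0; rewrite /diffquot lee_pdivlMr// -(edom_fineK f_ninfty fx) -EFinM.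
by rewrite leeBrDl.
Qed.

Lemma diffquot_gt x u r t : edom f x -> 0 < t ->
  (r%:E < diffquot f x u t)%E = ((fine (f x) + r * t)%:E < f (x + t *: u)%R)%E.
Proof.
move=> fx t0; rewrite /diffquot lte_pdivlMr// -(edom_fineK f_ninfty fx) -EFinM.
by rewrite lteBrDl.
Qed.

Lemma at_right0_itv {e : R} : 0 < e -> (0 : R)^'+ [set t | 0 < t < e].
Proof.
by move=> e0; near=> t => /=; apply/andP; split.
Unshelve. all: by end_near. Qed.

Lemma radial_subderiv_ge x u r e : edom f x -> 0 < e ->
  (forall t, 0 < t < e -> ((fine (f x) + r * t)%:E <= f (x + t *: u)%R)%E) ->
  (r%:E <= radial_subderiv f x u)%E.
Proof.
move=> fx e0 fr; refine (limf_einf_ge (at_right0_itv e0) _) => t /= te.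
by rewrite diffquot_ge ?fr//; case/andP: te.
Qed.

Lemma radial_subderiv_gt x u r : edom f x -> (r%:E < radial_subderiv f x u)%E ->
  exists2 e, 0 < e &
    forall t, 0 < t < e -> ((fine (f x) + r * t)%:E < f (x + t *: u)%R)%E.
Proof.
move=> fx /limf_einf_gt_ex[V [e /= e0 eV] rV]; exists e => // t /andP[t0 te].
rewrite -diffquot_gt//; apply: rV; apply: eV => //=.
by rewrite sub0r normrN gtr0_norm.
Qed.

(* The supremum of the times at which [f] lies below the line of slope [r]
   through [f x] is attained by lower semicontinuity. *)
Lemma radial_mean_value x w r t : lower_semicontinuous f ->
    edom f x -> 0 < t -> ((fine (f x) + r * t)%:E < f (x + t *: w)%R)%E ->
  exists s, [/\ 0 <= s < t, edom f (x + s *: w) &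
    forall c, 0 < c ->
      ((c * r)%:E <= radial_subderiv f (x + s *: w)%R (c *: w)%R)%E].
Proof.
move=> f_lsc fx t0 ft.
pose c := fine (f x).
pose A := [set s | 0 <= s <= t /\ (f (x + s *: w)%R <= (c + r * s)%:E)%E].
have A0 : A 0.
  split; first by rewrite lexx ltW.
  by rewrite scale0r addr0 mulr0 addr0 (edom_fineK f_ninfty).
have Aub : ubound A t by move=> s [/andP[]].
have supA : has_sup A by split; [exists 0|exists t].
set s := sup A.
have s0 : 0 <= s by apply: ub_le_sup => //; exists t.
have st : s <= t by apply: ge_sup => //; exists 0.
have As : (f (x + s *: w)%R <= (c + r * s)%:E)%E.
  rewrite leNgt; apply/negP => fs.
  have [b cb bf] := ereal_gt_dense fs.
  have [V nV fV] := f_lsc _ _ bf.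
  have : \forall s' \near s, V (x + s' *: w) /\ c + r * s' < b.
    apply: filterI.
      have h : (fun s' : R => x + s' *: w) @ s --> x + s *: w.
        by apply: cvgD; [exact: cvg_cst|apply: cvgZr_tmp; exact: cvg_id].
      exact: h.
    have h : (fun s' : R => c + r * s') @ s --> c + r * s.
      by apply: cvgD; [exact: cvg_cst|apply: cvgMl_tmp; exact: cvg_id].
    exact: cvgr_lt h _ cb.
  move=> [e /= e0 eV].
  have [s' As' ss'] := sup_adherent e0 supA.
  have /eV[/fV bf' cb'] : ball_ Num.norm s e s'.
    have ? : s' <= s by apply: ub_le_sup => //; exists t.
    by rewrite /ball_/= ger0_norm ?subr_ge0//; rewrite -/s in ss'; lra.
  case: As' => _; rewrite leNgt => /negP; apply.
  by apply: lt_trans bf'; rewrite lte_fin.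
have s_lt : s < t.
  rewrite lt_neqAle st andbT; apply/eqP => E.
  by move: As; rewrite E leNgt ft.
have fs : edom f (x + s *: w) by exact: le_lt_trans As (ltry _).
exists s; split => //; first by rewrite s0.
(* Beyond [s] and up to [t], [f] lies above the line, and at [s] on or below it, so quotients from
   [s] are at least [r]; moving along [d w] multiplies slopes by [d]. *)
move=> d d0; apply: (@radial_subderiv_ge _ _ _ ((t - s) / d)) => //.
  by rewrite divr_gt0// subr_gt0.
move=> h /andP[h0 hts].
have hd : 0 < h * d < t - s by rewrite mulr_gt0//= -ltr_pdivlMr.
rewrite -addrA scalerA -scalerDl; apply: (@le_trans _ _ ((c + r * (s + h * d))%:E)).
  move: As; rewrite -(edom_fineK f_ninfty fs) !lee_fin mulrDr addrA => As.
  by rewrite (_ : d * r * h = r * (h * d)) ?lerD2r//; ring.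
rewrite leNgt; apply/negP => lt_f.
have : s + h * d <= s.
  by apply: ub_le_sup => //; [exists t|split; [lra|exact: ltW]].
lra.
Qed.

End subderivatives.

Lemma ereal_le_dense {R : realType} (a b : \bar R) :
  (forall r : R, (r%:E < a)%E -> (r%:E <= b)%E) -> (a <= b)%E.
Proof.
move=> ab; rewrite leNgt; apply/negP => ba.
have [r br ra] : exists2 r : R, (b < r%:E)%E & (r%:E < a)%E.
  case: b ba {ab} => [b| |]; last 2 first.
      by rewrite ltNge leey.
      case: a => [a| |//] _; last by exists 0; rewrite ?ltNyr ?ltry.
      by exists (a - 1); rewrite ?ltNyr// lte_fin; lra.
    by move=> /ereal_gt_dense[r br ra]; exists r.
by move: (ab _ ra); rewrite leNgt br.
Qed.

(** * Upper limits along directionally convergent sequences *)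

Section directional_limits.
Context {R : realType} {X : normedModType R}.
Implicit Types (f F G : X -> \bar R) (x u v a : X).

(** Moving the points [x n = a + t n w n] by [o(t n)] changes [w n] by [o(1)] only, so the direction
    [v] survives and a local comparison suffices. *)
Lemma dir_limsup_le f v a F G :
    (forall x (r e : R), edom f x -> 0 < e -> (r%:E < F x)%E ->
      exists y, [/\ edom f y, `|y - x| < e & (r%:E <= G y)%E]) ->
  (dir_limsup f v a F <= dir_limsup f v a G)%E.
Proof.
move=> FG; apply: ge_ereal_sup => _ [x [[t [w [t0 cvgt cvgw xE]]] xf] <-].
apply: ereal_le_dense => r rF.
have /choice[y yP] n : exists y, [/\ edom f y, `|y - x n| < t n * n.+1%:R^-1 &
    (r%:E < F (x n))%E -> (r%:E <= G y)%E].
  have [rFn|] := ltP r%:E (F (x n)).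
    have [|y [? ? ?]] := FG (x n) r (t n * n.+1%:R^-1) (xf n) _ rFn.
      by rewrite mulr_gt0// invr_gt0.
    by exists y.
  move=> _; exists (x n); split => //.
  by rewrite subrr normr0 mulr_gt0// invr_gt0.
have cvgy : dir_cvg v a y.
  exists t, (fun n => w n + (t n)^-1 *: (y n - x n)); split => //; last first.
    move=> n; rewrite scalerDr scalerA mulfV ?gt_eqF// scale1r.
    by rewrite addrA -xE addrCA subrr addr0.
  rewrite -[v]addr0; apply: cvgD => //; apply/cvgr0Pnorm_lt => e e0.
  near=> n; rewrite normrZ normfV gtr0_norm// ltr_pdivrMl//.
  have [_ yx _] := yP n; apply: lt_trans yx _; rewrite ltr_pM2l//.
  near: n; exact: near_infty_natSinv_lt (PosNum e0).
apply: (@le_trans _ _ (limn_esup (G \o y))); last first.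
  by apply: ereal_sup_ubound; exists y => //; split => // n; case: (yP n).
apply: limf_esup_ge_ex => V nV; have [n Vn rn] := limf_esup_gt_ex rF nV.
by exists n => //=; case: (yP n) => _ _; apply.
Unshelve. all: by end_near. Qed.

Lemma le_dir_limsup_cst f a F : edom f a -> (F a <= dir_limsup f (0 : X)%R a F)%E.
Proof.
move=> fa; apply: le_ereal_sup_tmp; exists (limn_esup (F \o (fun=> a))).
  exists (fun=> a) => //; split => //.
  exists harmonic, (fun=> 0); split => //.
  - by move=> n; exact: harmonic_gt0.
  - exact: cvg_harmonic.
  - exact: cvg_cst.
  - by move=> n; rewrite scaler0 addr0.
apply: limf_esup_ge_ex => V nV; have [n Vn] := @filter_ex _ _ _ V nV.
by exists n.
Qed.

(** * Lower bounds for the radial subderivative at nearby points *)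

Section radial.
Variable f : X -> \bar R.
Hypotheses (f_ninfty : ninfty_free f) (f_lsc : lower_semicontinuous f).

(** The mean value inequality starts at some [a + s u] rather than at [a], so that the point found
    differs from [a]. At [x = a + s u] the direction [u + al (a - x)] is [(1 - al s) u], a positive
    multiple of [u] for small [s]. *)
Lemma radial_subderiv_approx a u (al r e : R) : edom f a ->
    radially_accessible f a u -> 0 <= al -> 0 < e ->
    (r%:E < radial_subderiv f a u)%E ->
  exists s, [/\ 0 < s < e, edom f (a + s *: u) &
    (r%:E <= radial_subderiv f (a + s *: u)%R
               (u + al *: (a - (a + s *: u)))%R)%E].
Proof.
move=> fa acc al0 e0 /ereal_gt_dense[r' rr' r'f].
have [e1 e10 fr'] := radial_subderiv_gt f_ninfty fa r'f.
(* [al t < 1] keeps [1 - al s] positive for [s <= t]; the bound on [al t |r'|] keeps [(1 - al s) r']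
   above [r]. *)
have [t [t0 te te1 tal talr]] : exists t, [/\ 0 < t, t < e, t < e1, al * t < 1 &
    al * t * `|r'| < r' - r].
  suff : \forall t \near (0 : R)^'+, [/\ 0 < t, t < e, t < e1, al * t < 1 &
      al * t * `|r'| < r' - r] by move=> /filter_ex.
  have al1 : 0 < al + 1 by lra.
  have r'1 : 0 < `|r'| + 1 by rewrite ltr_wpDl.
  near=> t.
  have t0 : 0 < t by [].
  have t1 : t < 1 / (al + 1) by near: t; apply: nbhs_right_lt; rewrite divr_gt0.
  have t2 : t < (r' - r) / ((al + 1) * (`|r'| + 1)).
    by near: t; apply: nbhs_right_lt; rewrite divr_gt0// ?mulr_gt0//; lra.
  move: t1 t2; rewrite !ltr_pdivlMr ?mulr_gt0// => t1 t2.
  split => //; [nra|]; have := normr_ge0 r'; nra.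
pose c := fine (f a).
have /ereal_gt_dense[b cb bt] : ((c + r' * t)%:E < f (a + t *: u)%R)%E.
  by apply: fr'; rewrite t0.
(* [d] is the value at time 0 of the line of slope [r'] with value [b] at time [t]. As [c < d], a
   start [s] with [f (a + s u) < (c + d) / 2] and [|r'| s < (d - c) / 2] leaves a mean slope above
   [r'] on [[s, t]]. *)
pose d := b - r' * t.
have dc : c < d by rewrite /d; lra.
have nV : (0 : R)^'+ [set s | 0 < s < t /\ `|r'| * s < (d - c) / 2].
  have r'1 : 0 < `|r'| + 1 by rewrite ltr_wpDl.
  near=> s; have s0 : 0 < s by [].
  have : s < (d - c) / 2 / (`|r'| + 1).
    by near: s; apply: nbhs_right_lt; rewrite !divr_gt0//; lra.
  rewrite ltr_pdivlMr// => s1; split; last by have := normr_ge0 r'; nra.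
  by rewrite s0/=; near: s; exact: nbhs_right_lt.
have : (limf_einf (fun s : R => f (a + s *: u)%R) (0 : R)^'+ < ((c + d) / 2)%:E)%E.
  by rewrite -acc -(edom_fineK f_ninfty fa) lte_fin; rewrite -/c; lra.
move=> /limf_einf_lt_ex/(_ nV)[s [/andP[s0 st] r's] fs].
have fs' : edom f (a + s *: u) by exact: lt_trans fs (ltry _).
have : ((fine (f (a + s *: u)) + r' * (t - s))%:E
    < f ((a + s *: u) + (t - s) *: u)%R)%E.
  rewrite -addrA -scalerDl addrCA subrr addr0; apply: lt_trans bt.
  move: fs; rewrite -(edom_fineK f_ninfty fs') !lte_fin => fs.
  have /andP[r'N _] : - `|r'| <= r' <= `|r'| by rewrite -ler_norml.
  have : - (`|r'| * s) <= r' * s by nra.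
  by rewrite /d in fs r's; lra.
move=> /(radial_mean_value f_ninfty f_lsc fs')[|s' [/andP[s'0 s'ts] fs'' fr]].
  by rewrite subr_gt0.
have E : a + s *: u + s' *: u = a + (s + s') *: u by rewrite scalerDl addrA.
rewrite E in fs'' fr; exists (s + s'); split => //; first by apply/andP; split; lra.
have -> : u + al *: (a - (a + (s + s') *: u)) = (1 - al * (s + s')) *: u.
  by rewrite opprD addrA subrr add0r scalerN scalerA scalerBl scale1r.
have als : al * (s + s') <= al * t by rewrite ler_wpM2l//; lra.
apply: le_trans (fr _ _); last by lra.
have h : al * (s + s') * r' <= al * t * `|r'|.
  apply: (@le_trans _ _ (al * (s + s') * `|r'|)).
    by rewrite ler_wpM2l ?ler_norm// mulr_ge0//; lra.
  by rewrite ler_wpM2r.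
by rewrite lee_fin; lra.
Unshelve. all: by end_near. Qed.

Lemma radial_subderiv_le_dir_limsup a u (al : R) : edom f a ->
    radially_accessible f a u -> 0 <= al ->
  (radial_subderiv f a u <=
    dir_limsup f u a (fun x => radial_subderiv f x (u + al *: (a - x))%R))%E.
Proof.
move=> fa acc al0; apply: ereal_le_dense => r rf.
have /choice[s sP] n := radial_subderiv_approx fa acc al0 (harmonic_gt0 n) rf.
apply: le_ereal_sup_tmp; exists (limn_esup ((fun x =>
    radial_subderiv f x (u + al *: (a - x))%R) \o (fun n => a + s n *: u))).
  exists (fun n => a + s n *: u) => //; split; last by move=> n; case: (sP n).
  exists s, (fun=> u); split => //.
  - by move=> n; case: (sP n) => /andP[].
  - apply: (@squeeze_cvgr _ _ _ _ (fun=> 0) harmonic).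
    + by near=> n; case: (sP n) => /andP[/ltW -> /ltW ->].
    + exact: cvg_cst.
    + exact: cvg_harmonic.
  - exact: cvg_cst.
apply: limf_esup_ge_ex => V nV; have [n Vn] := @filter_ex _ _ _ V nV.
by exists n => //=; case: (sP n).
Unshelve. all: by end_near. Qed.

(** The infimum over a ball around [w] in [upper_subderiv] lets the direction vary with the base
    point: for [y] close to [x], [wy] lies in that ball, so quotients from [y] along [wy] can be
    bounded below. *)
Lemma subdiff_C_approx a u x (l : dual X) (al r e : R) : subdiff_C f x l ->
    0 <= al -> 0 < e -> r < pairing l (u + al *: (a - x)) ->
  exists y, [/\ edom f y, `|y - x| < e &
    (r%:E <= radial_subderiv f y (u + al *: (a - y))%R)%E].
Proof.
move=> [fx lC] al0 e0; set w := u + al *: (a - x).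
move=> rl; pose r' := (r + pairing l w) / 2.
have rr' : r < r' by rewrite /r'; lra.
have : (r'%:E < upper_subderiv f x w)%E.
  by apply: lt_le_trans (lC w); rewrite lte_fin /r'; lra.
move=> /ereal_sup_gt[_ [d /= d0 <-] r'd].
have al1 : 0 < al + 1 by lra.
have r'1 : 0 < `|r'| + 1 by rewrite ltr_wpDl.
(* Since [w - wy = al (y - x)], the bound [d / (al + 1)] puts [wy] within [d] of [w], also when
   [al = 0]. *)
pose e' := Num.min (e / 2) (d / (al + 1)).
have e'0 : 0 < e' by rewrite lt_min !divr_gt0.
have [t0 [t00 t0al t0alr t0e]] : exists t, [/\ 0 < t, al * t < 1,
    al * t * `|r'| < r' - r & t * (`|w| + d) < e / 2].
  suff : \forall t \near (0 : R)^'+, [/\ 0 < t, al * t < 1,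
    al * t * `|r'| < r' - r & t * (`|w| + d) < e / 2] by move=> /filter_ex.
  have wd : 0 < `|w| + d by rewrite ltr_wpDl.
  near=> t.
  have t0 : 0 < t by [].
  have t1 : t < 1 / (al + 1) by near: t; apply: nbhs_right_lt; rewrite divr_gt0.
  have t2 : t < (r' - r) / ((al + 1) * (`|r'| + 1)).
    by near: t; apply: nbhs_right_lt; rewrite divr_gt0// ?mulr_gt0//; lra.
  have t3 : t < e / 2 / (`|w| + d).
    by near: t; apply: nbhs_right_lt; rewrite !divr_gt0.
  move: t1 t2 t3; rewrite !ltr_pdivlMr ?mulr_gt0// => t1 t2 t3.
  split => //; [nra|]; have := normr_ge0 r'; nra.
have nV : filter_prod (0 : R)^'+ (graph_nbhs f x)
    [set p | 0 < p.1 < t0 /\ (ball x e' p.2 /\ edom f p.2)].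
  exists ([set t | 0 < t < t0], [set y | ball x e' y /\ edom f y]); last by [].
  split; first exact: at_right0_itv.
  exists [set p | ball x e' p.1 /\ (p.2 < +oo)%E]; last by [].
  exists (ball x e', [set b | (b < +oo)%E]); last by move=> p [].
  split => /=; first exact: nbhsx_ballx.
  by apply: open_nbhs_nbhs; split; [exact: open_ereal_lt_ereal|exact: fx].
have [[t y] /= [/andP[tg0 tt0] [xy fy]] r'q] := limf_esup_gt_ex r'd nV.
have xye : `|x - y| < e' by move: xy; rewrite -ball_normE.
pose wy := u + al *: (a - y).
have wyE : w - wy = al *: (y - x).
  rewrite /w /wy opprD addrACA subrr add0r -scalerBr opprB addrC addrA subrK.
  by [].
have wyd : ball w d wy.
  rewrite -ball_normE /= wyE normrZ ger0_norm// distrC.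
  have : `|x - y| < d / (al + 1) by apply: lt_le_trans xye _; rewrite ge_min lexx orbT.
  by rewrite ltr_pdivlMr//; have := normr_ge0 (x - y); nra.
have {}r'q : (r'%:E < diffquot f y wy t)%E.
  by apply: lt_le_trans r'q _; apply: ereal_inf_lbound; exists wy.
rewrite diffquot_gt// in r'q.
have [s [/andP[s0 st] fs fr]] := radial_mean_value f_ninfty f_lsc fy tg0 r'q.
exists (y + s *: wy); split => //.
- have -> : y + s *: wy - x = (y - x) + s *: wy by rewrite addrAC.
  apply: le_lt_trans (ler_normD _ _) _; rewrite normrZ ger0_norm// distrC.
  have : `|x - y| < e / 2 by apply: lt_le_trans xye _; rewrite ge_min lexx.
  have : `|wy| <= `|w| + d.
    rewrite -[wy](subrK w) addrC; apply: le_trans (ler_normD _ _) _.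
    by rewrite lerD2l distrC; move: wyd; rewrite -ball_normE => /ltW.
  by have := normr_ge0 wy; nra.
(* Directions attached to points of the segment stay parallel to [wy], so the mean value inequality
   applies with factor [1 - al s]. *)
have -> : u + al *: (a - (y + s *: wy)) = (1 - al * s) *: wy.
  by rewrite opprD addrA scalerDr addrA -/wy scalerN scalerA scalerBl scale1r.
have als : al * s <= al * t0 by rewrite ler_wpM2l//; lra.
apply: le_trans (fr _ _); last by lra.
have h : al * s * r' <= al * t0 * `|r'|.
  apply: (@le_trans _ _ (al * s * `|r'|)).
    by rewrite ler_wpM2l ?ler_norm// mulr_ge0//; lra.
  by rewrite ler_wpM2r.
by rewrite lee_fin; lra.
Unshelve. all: by end_near. Qed.

End radial.
End directional_limits.

(** * Ekeland's variational principle *)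

(** Closed sublevel sets on [C] express lower semicontinuity of [G] extended by [+oo] outside [C]. A
    sequence descending in the order given by [S] and nearly minimising [G] at each stage is Cauchy,
    and its limit is minimal. *)
Lemma ekeland {R : realType} {X : completeNormedModType R} (C : set X)
    (G : X -> R) (b e : R) (a : X) : 0 < e -> C a ->
    (forall c, closed [set x | C x /\ G x <= c]) ->
    (forall x, C x -> b <= G x) ->
  exists x, [/\ C x, G x <= G a & forall y, C y -> G x <= G y + e * `|y - x|].
Proof.
move=> e0 Ca closedG bG.
pose S x := [set y | C y /\ G y + e * `|y - x| <= G x].
have Sxx x : C x -> S x x by split; rewrite ?subrr ?normr0 ?mulr0 ?addr0.
have Strans x y z : S x y -> S y z -> S x z.
  move=> [_ yx] [Cz zy]; split => //.
  by have := ler_distD y z x; have := normr_ge0 (z - y); nra.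
have /choice[next nextP] (p : nat * X) : exists y, C p.2 -> S p.2 y /\
    forall z, S p.2 z -> G y <= G z + harmonic p.1.
  have [Cp|] := pselect (C p.2); last by exists a.
  have Sinf : has_inf (G @` S p.2).
    split; first by exists (G p.2), p.2 => //; exact: Sxx.
    by exists b => _ [y [Cy _] <-]; exact: bG.
  have [_ [y Sy <-] yinf] := inf_adherent (harmonic_gt0 p.1) Sinf.
  exists y => _; split => // z Sz; apply: le_trans (ltW yinf) _.
  by rewrite lerD2r; apply: ge_inf; [case: Sinf|exists z].
pose x := fix x n := if n is m.+1 then next (m, x m) else a.
have Cx n : C (x n) by elim: n => // n Cn; have [[]] := nextP (n, x n) Cn.
have Sx n : S (x n) (x n.+1) by have [] := nextP (n, x n) (Cx n).
have xmin n z : S (x n) z -> G (x n.+1) <= G z + harmonic n.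
  by have [_] := nextP (n, x n) (Cx n); exact.
have Sxm n m : (n <= m)%N -> S (x n) (x m).
  elim: m => [|m IHm]; first by rewrite leqn0 => /eqP ->; exact: Sxx.
  rewrite leq_eqVlt => /predU1P[->|]; first exact: Sxx.
  by rewrite ltnS => /IHm nm; exact: Strans nm (Sx m).
(* For [m > N], [x m] lies below both [x N] and [x N.+1]: the former gives
   [G (x N.+1) - G (x m) <= 1 / (N + 1)], the latter bounds [e |x m - x N.+1|] by that
   difference. *)
have : cauchy (x @ \oo).
  apply: cauchy_exP => d d0.
  have [N _ NP] := near_infty_natSinv_lt (PosNum (mulr_gt0 e0 d0)).
  exists (x N.+1); exists N.+1 => // m /= Nm.
  have [_ xm] := Sxm _ _ Nm; have := xmin _ _ (Strans _ _ _ (Sx N) (Sxm _ _ Nm)).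
  have := NP N (leqnn N); rewrite -ball_normE /= distrC /harmonic /= => h1 h2.
  rewrite -(ltr_pM2l e0); apply: le_lt_trans h1.
  by rewrite -(lerD2l (G (x m))); exact: le_trans xm h2.
move=> /cauchy_cvg/cvg_ex[l xl].
have Sxl n : S (x n) l.
  (* Closedness concerns a fixed level, so [|x m - x n|] is replaced by [|l - x n|] at the cost of a
     slack [d], which then tends to 0. *)
  have h d : 0 < d -> C l /\ G l <= G (x n) - e * `|l - x n| + d.
    move=> d0; apply: (closed_cvg _ (closedG _) _ _ xl).
    have near_l : \forall m \near \oo, `|l - x m| < d / e.
      by move/cvgrPdist_lt : xl; apply; rewrite divr_gt0.
    near=> m; split; first exact: Cx.
    have [_ xm] : S (x n) (x m) by apply: Sxm; near: m; exact: nbhs_infty_ge.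
    have : `|l - x m| < d / e by near: m.
    rewrite ltr_pdivlMr// => ld.
    by have := ler_distD (x m) l (x n); nra.
  split; first by have [] := h 1 ltr01.
  by rewrite -lerBrDr; apply/ler_addgt0Pr => d /h[].
have [Cl la] := Sxl 0; exists l; split => //.
  by have := normr_ge0 (l - a); rewrite /= in la; nra.
move=> y Cy; rewrite leNgt; apply/negP => yl.
(* A violating [y] lies below [l], hence below every [x n]; then
   [G l <= G (x N.+1) <= G y + 1 / (N + 1)], impossible for large [N]. *)
have Sly : S l y by split => //; exact: ltW.
have yl' : 0 < G l - G y by have := normr_ge0 (y - l); nra.
have [N _ NP] := near_infty_natSinv_lt (PosNum yl').
have hN : harmonic N < G l - G y by exact: NP N (leqnn N).
have := xmin _ _ (Strans _ _ _ (Sxl N) Sly); have [_] := Sxl N.+1.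
have := mulr_ge0 (ltW e0) (normr_ge0 (l - x N.+1)).
move: (x N.+1) (harmonic N) hN => z h hN h1 h2 h3; lra.
Unshelve. all: by end_near. Qed.

(** * Convex Lipschitz penalties and their Clarke subgradients *)

Section convex_penalty.
Context {R : realType} {X : normedModType R}.
Implicit Types (psi : X -> R) (x v y : X).

(** Bound and attainment together make [phi] a minimum over [s] and supply a minimising [s] at each
    point, which the estimates use directly. *)
Definition penalty_of (lam K t : R) (x v : X) (phi : X -> R) :=
  (forall y s, 0 <= s <= t -> phi y <= - lam * s + K * `|y - (x + s *: v)|) /\
  (forall y, exists2 s, 0 <= s <= t & phi y = - lam * s + K * `|y - (x + s *: v)|).

Lemma penalty_exists (lam K t : R) x v : 0 <= t ->
  exists phi, penalty_of lam K t x v phi.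
Proof.
move=> t0.
have /choice[s sP] y : exists s, 0 <= s <= t /\ forall s', 0 <= s' <= t ->
    - lam * s + K * `|y - (x + s *: v)| <= - lam * s' + K * `|y - (x + s' *: v)|.
  have [|s st smin] := @EVT_min R
      (fun s => - lam * s + K * `|y - (x + s *: v)|) 0 t t0.
    apply: continuous_subspaceT => s; apply: cvgD.
      by apply: cvgMl_tmp; exact: cvg_id.
    apply: cvgMl_tmp; apply: cvg_norm; apply: cvgB; first exact: cvg_cst.
    by apply: cvgD; [exact: cvg_cst|apply: cvgZr_tmp; exact: cvg_id].
  exists s; split=> [|s' s't]; first by rewrite in_itv/= in st.
  by apply: smin; rewrite in_itv.
exists (fun y => - lam * s y + K * `|y - (x + s y *: v)|); split => y.
  by move=> s' s't; have [_] := sP y; exact.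
by exists (s y) => //; have [] := sP y.
Qed.

Section properties.
Variables (lam K t : R) (x v : X) (phi : X -> R).
Hypotheses (K0 : 0 <= K) (phiP : penalty_of lam K t x v phi).

(** The minimised expression is jointly convex in [(y, s)], and partial minimisation over an
    interval preserves convexity. *)
Lemma penalty_convex y z c : 0 <= c <= 1 ->
  phi (c *: y + (1 - c) *: z) <= c * phi y + (1 - c) * phi z.
Proof.
move=> /andP[c0 c1]; have [phile phiex] := phiP.
have [s /andP[s0 st] ->] := phiex y; have [s' /andP[s'0 s't] ->] := phiex z.
have ss't : 0 <= c * s + (1 - c) * s' <= t by apply/andP; split; nra.
apply: le_trans (phile _ _ ss't) _.
have -> : c *: y + (1 - c) *: z - (x + (c * s + (1 - c) * s') *: v) =
    c *: (y - (x + s *: v)) + (1 - c) *: (z - (x + s' *: v)).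
  rewrite !scalerBr addrACA -opprD; congr (_ - _).
  by rewrite !scalerDr !scalerA addrACA -!scalerDl (addrC c (1 - c)) subrK scale1r.
have : `|c *: (y - (x + s *: v)) + (1 - c) *: (z - (x + s' *: v))| <=
    c * `|y - (x + s *: v)| + (1 - c) * `|z - (x + s' *: v)|.
  apply: le_trans (ler_normD _ _) _.
  by rewrite !normrZ (ger0_norm c0) ger0_norm// subr_ge0.
by move=> /(ler_wpM2l K0); lra.
Qed.

Lemma penalty_lipschitz y z : `|phi y - phi z| <= K * `|y - z|.
Proof.
have lip y' z' : phi y' - phi z' <= K * `|y' - z'|.
  have [phile phiex] := phiP.
  have [s st ->] := phiex z'; have := phile y' s st.
  by have := ler_wpM2l K0 (ler_distD z' y' (x + s *: v)); lra.
by rewrite ler_norml lip andbT lerNl opprB distrC lip.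
Qed.

End properties.

Lemma lipschitz_continuous psi (K : R) :
  (forall y z, `|psi y - psi z| <= K * `|y - z|) -> continuous psi.
Proof.
move=> lip y; apply/cvgrPdist_lt => e e0.
have K1 : 0 < `|K| + 1 by rewrite ltr_wpDl.
near=> z; apply: le_lt_trans (lip _ _) _.
have : `|y - z| < e / (`|K| + 1).
  by near: z; apply: cvgr_dist_lt; rewrite ?divr_gt0.
by rewrite ltr_pdivlMr//; have := ler_norm K; have := normr_ge0 (y - z); nra.
Unshelve. all: by end_near. Qed.

(** By convexity, the quotient at [y] along [v] for [0 < t < 1] is at most [psi (y + v) - psi y],
    which is continuous in [y]; so Clarke subgradients are convex subgradients. *)
Lemma convex_subdiff_C psi x (m : dual X) v :
    convex_efun (EFin \o psi) -> continuous psi ->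
    subdiff_C (EFin \o psi) x m -> pairing m v <= psi (x + v) - psi x.
Proof.
move=> psi_cvx psi_cont [_ /(_ v)] mC; rewrite -lee_fin.
apply: (le_trans mC); apply: ge_ereal_sup => _ [d /= d0 <-].
apply/lee_addgt0Pr => e e0.
have nV : filter_prod (0 : R)^'+ (graph_nbhs (EFin \o psi) x)
    [set p | 0 < p.1 < 1 /\ psi (p.2 + v) - psi p.2 < psi (x + v) - psi x + e].
  exists ([set t | 0 < t < 1],
    [set y | psi (y + v) - psi y < psi (x + v) - psi x + e]); last by [].
  split; first exact: at_right0_itv.
  exists [set p | psi (p.1 + v) - psi p.1 < psi (x + v) - psi x + e]; last by [].
  exists ([set y | psi (y + v) - psi y < psi (x + v) - psi x + e], setT);
    last by move=> p [].
  split; last exact: filterT.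
  have h : (fun y => psi (y + v) - psi y) @ x --> psi (x + v) - psi x.
    apply: cvgB; last exact: psi_cont.
    apply: (@cvg_comp _ _ _ (fun y => y + v) psi); last exact: psi_cont.
    by apply: cvgD; [exact: cvg_id|exact: cvg_cst].
  by apply: (cvgr_lt _ h); rewrite ltrDl.
apply: (limf_esup_le nV) => -[t y] /= [/andP[t0 t1] ye].
apply: le_trans (ereal_inf_lbound _) _; first by exists v => //; exact: ballxx.
rewrite /diffquot lee_pdivrMr// /= -EFinB -EFinD -EFinM lee_fin.
have : 0 <= t <= 1 by rewrite !ltW.
move=> /(psi_cvx (y + v) y); rewrite /= -!EFinM -EFinD lee_fin.
have -> : t *: (y + v) + (1 - t) *: y = y + t *: v.
  by rewrite scalerDr addrAC -scalerDl (addrC t) subrK scale1r.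
nra.
Qed.

End convex_penalty.

(** * Subgradients of prescribed slope from the Separation Principle *)

Section subdifferential.
Context {R : realType}.

(** Split [0 = l + m]: the convex subgradient inequality at [x + h w] gives [m w <= c], so
    [l w >= - c]. Weak-star convergence passes this to a member of the net, and the [net_limsup]
    condition controls the correction [al (x - y)]. *)
Lemma separation_approx {X : normedModType R} (D : subdiff_op X)
    (f : X -> \bar R) (psi : X -> R) (K : R) (x w : X) (c h al e : R) :
    is_subdifferential D -> ninfty_free f -> lower_semicontinuous f ->
    convex_efun (EFin \o psi) ->
    (forall y z, `|psi y - psi z| <= K * `|y - z|) ->
    edom f x -> local_min (fun y => f y + (psi y)%:E)%E x ->
    0 < h -> psi (x + h *: w) - psi x <= h * c -> 0 <= al -> 0 < e ->
  exists y l, [/\ D f y l, `|y - x| < e &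
    - c - e < pairing l (w + al *: (x - y))].
Proof.
move=> [D_MRC D_sep] f_ninfty f_lsc psi_cvx psi_lip fx min_x h0 psi_w al0 e0.
have psi_cont : continuous psi by exact: lipschitz_continuous psi_lip.
have psi_ninfty : ninfty_free (EFin \o psi) by [].
have psi_lsc : lower_semicontinuous (EFin \o psi).
  move=> y a /=; rewrite lte_fin => ay; exists [set z | a < psi z].
    exact: (cvgr_gt _ (psi_cont y)).
  by move=> z; rewrite /= lte_fin.
have psi_near : lipschitz_near (EFin \o psi) x.
  exists setT; first exact: filterT.
  split=> // ; exists K; split; first exact: num_real.
  move=> M KM [y z] _ /=; apply: le_trans (psi_lip _ _) _.
  by rewrite ler_wpM2r// ltW.
have [l [m [lhat Dm lm]]] := D_sep f (EFin \o psi) x f_ninfty f_lsc psi_ninfty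
  psi_lsc psi_cvx psi_near fx min_x.
have m_w : pairing m w <= c.
  have psi_proper : proper_efun (EFin \o psi) by split => //; exists x; exact: ltry.
  have mC := (D_MRC _ psi_proper psi_lsc x).2 _ Dm.
  have := convex_subdiff_C (h *: w) psi_cvx psi_cont mC.
  have -> : pairing m (h *: w) = h * pairing m w by rewrite /pairing linearZ.
  by move=> /le_trans/(_ psi_w); rewrite ler_pM2l.
have l_w : - c <= pairing l w by have := lm w; lra.
have [I [le [xs [ls [[_ _ le_trans_I dirI] Dls cvg_xs cvg_ls lim_le0]]]]] := lhat.
have [i0 _ i0P] : net_tails le [set i | `|xs i - x| < e].
  have : nbhs (x, f x) [set p | ball x e p.1].
    exists (ball x e, setT); last by move=> p [].
    by split; [exact: nbhsx_ballx|exact: filterT].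
  move=> /cvg_xs[i _ iP]; exists i => // j /iP /=.
  by rewrite -ball_normE /= distrC.
have [i1 _ i1P] : net_tails le [set i | `|pairing l w - pairing (ls i) w| < e / 2].
  have : nbhs (pairing l w) (ball (pairing l w) (e / 2)) by apply: nbhsx_ballx; lra.
  by move=> /(cvg_ls w)[i _ iP]; exists i.
have al1 : 0 < al + 1 by lra.
(* Multiplied by [al], this bound stays below [e / 2], also when [al = 0]; a negative pairing only
   helps. *)
have [i2 i2P] : exists i, forall j, le i j ->
    pairing (ls j) (xs j - x) < e / 2 / (al + 1).
  have : (net_limsup le (fun i => (pairing (ls i) (xs i - x)%R)%:E) <
      (e / 2 / (al + 1))%:E)%E.
    by apply: le_lt_trans lim_le0 _; rewrite lte_fin !divr_gt0.
  move=> /ereal_inf_lt[_ [i _ <-] iP]; exists i => j ij.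
  rewrite -lte_fin; apply: le_lt_trans iP; apply: ereal_sup_ubound.
  by exists j.
have [j [i0j i1j]] := dirI i0 i1; have [k [jk i2k]] := dirI j i2.
exists (xs k), (ls k); split => //.
  by apply: i0P => /=; exact: le_trans_I jk.
have -> : pairing (ls k) (w + al *: (x - xs k)) =
    pairing (ls k) w - al * pairing (ls k) (xs k - x).
  by rewrite -opprB scalerN /pairing linearB linearZ.
have := i2P k i2k; rewrite ltr_pdivlMr// => k2.
have /i1P /= : le i1 k by exact: le_trans_I jk.
rewrite ltr_norml => /andP[_ k1].
case: (leP 0 (pairing (ls k) (xs k - x))) => k3; nra.
Qed.

(** Provides the closedness required by [ekeland]: the set is the closed ball minus the set where
    [c - phi < f], which is open by semicontinuity. *)
Lemma closed_sublevel_addr {X : normedModType R} (f : X -> \bar R) (phi : X -> R)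
    (a : X) (rho c : R) : ninfty_free f -> lower_semicontinuous f ->
    continuous phi ->
  closed [set y | (`|y - a| <= rho /\ edom f y) /\ fine (f y) + phi y <= c].
Proof.
move=> f_ninfty f_lsc phi_cont.
have -> : [set y | (`|y - a| <= rho /\ edom f y) /\ fine (f y) + phi y <= c] =
    [set y | `|y - a| <= rho] `&` ~` [set y | ((c - phi y)%:E < f y)%E].
  apply/seteqP; split => y /=.
    move=> [[ya fy] fc]; split=> //; apply/negP; rewrite -leNgt.
    by rewrite -(edom_fineK f_ninfty fy) lee_fin lerBrDr.
  move=> [ya /negP]; rewrite -leNgt => fc.
  have fy : edom f y by exact: le_lt_trans fc (ltry _).
  by split => //; move: fc; rewrite -(edom_fineK f_ninfty fy) lee_fin lerBrDr.
apply: closedI.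
  apply: (@closed_comp _ _ (fun y => `|y - a|) [set r | r <= rho]).
    move=> y _; apply: cvg_norm.
    by apply: cvgB; [exact: cvg_id|exact: cvg_cst].
  exact: closed_le.
rewrite closedC openE => y /= /ereal_gt_dense[b cb bf].
have [V nV fV] := f_lsc _ _ bf.
have : \forall z \near y, V z /\ c - phi z < b.
  apply: filterI => //.
  have h : (fun z => c - phi z) @ y --> c - phi y.
    by apply: cvgB; [exact: cvg_cst|exact: phi_cont].
  exact: (cvgr_lt _ h).
apply: filterS => z [/fV bz cz].
by apply: lt_trans bz; rewrite lte_fin.
Qed.

Lemma subdiff_approx {X : completeNormedModType R} (D : subdiff_op X)
    (f : X -> \bar R) (x v : X) (al r e : R) : is_subdifferential D ->
    ninfty_free f -> lower_semicontinuous f -> edom f x -> 0 <= al -> 0 < e ->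
    (r%:E < radial_subderiv f x v)%E ->
  exists y l, [/\ D f y l, `|y - x| < e & r <= pairing l (v + al *: (x - y))].
Proof.
move=> D_subdiff f_ninfty f_lsc fx al0 e0 /ereal_gt_dense[lam r_lam lam_f].
pose F0 := fine (f x).
have [e1 e10 f_lam] := radial_subderiv_gt f_ninfty fx lam_f.
have [rho [rho0 rho_e rhoP]] : exists rho, [/\ 0 < rho, rho <= e / 2 &
    forall y, `|y - x| <= rho -> ((F0 - 1)%:E < f y)%E].
  have /f_lsc[V nV fV] : ((F0 - 1)%:E < f x)%E.
    by rewrite -(edom_fineK f_ninfty fx) lte_fin /F0; lra.
  have /nbhs_ballP[d /= d0 dV] := nV.
  exists (Num.min (e / 2) (d / 2)); split.
  - by rewrite lt_min !divr_gt0.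
  - by rewrite ge_min lexx.
  move=> y; rewrite le_min => /andP[_ yd]; apply: fV; apply: dV.
  by rewrite -ball_normE /= distrC; lra.
(* Three losses of at most [eta] occur: from the term [al s lam], from the Ekeland perturbation, and
   from the separation tolerance. *)
pose eta := (lam - r) / 4.
have eta0 : 0 < eta by rewrite /eta; lra.
have lam1 : 0 < `|lam| + 1 by rewrite ltr_wpDl.
have al1 : 0 < al + 1 by lra.
have v1 : 0 < `|v| + 1 by rewrite ltr_wpDl.
have [t [t0 te1 tal tallam tv]] : exists t, [/\ 0 < t, t < e1, al * t < 1,
    al * t * `|lam| < eta & t * `|v| < rho / 2].
  suff : \forall t \near (0 : R)^'+, [/\ 0 < t, t < e1, al * t < 1,
    al * t * `|lam| < eta & t * `|v| < rho / 2] by move=> /filter_ex.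
  near=> t.
  have t0 : 0 < t by [].
  have t1 : t < 1 / (al + 1) by near: t; apply: nbhs_right_lt; rewrite divr_gt0.
  have t2 : t < eta / ((al + 1) * (`|lam| + 1)).
    by near: t; apply: nbhs_right_lt; rewrite divr_gt0// mulr_gt0.
  have t3 : t < rho / 2 / (`|v| + 1).
    by near: t; apply: nbhs_right_lt; rewrite !divr_gt0.
  move: t1 t2 t3; rewrite !ltr_pdivlMr ?mulr_gt0// => t1 t2 t3.
  split => //; [nra| |]; first by have := normr_ge0 lam; nra.
  by have := normr_ge0 v; nra.
(* Near the end [x + t v], [f] is already above the line of slope [lam]; this excludes [s = t] at
   the Ekeland point. *)
have [d2 d20 d2P] : exists2 d, 0 < d & forall y, `|y - (x + t *: v)| < d ->
    ((F0 + lam * t)%:E < f y)%E.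
  have /f_lsc[V nV fV] : ((F0 + lam * t)%:E < f (x + t *: v)%R)%E.
    by apply: f_lam; rewrite t0.
  have /nbhs_ballP[d /= d0 dV] := nV.
  exists d => // y yd; apply: fV; apply: dV.
  by rewrite -ball_normE /= distrC.
pose dm := Num.min (rho / 2) d2.
have dm0 : 0 < dm by rewrite lt_min d20 divr_gt0.
(* At the Ekeland point, [f > F0 - 1] and [G <= F0] leave less than [2 + |lam| t] for the penalty
   term, so this [K] forces [|q| < dm]. *)
pose K := (2 + `|lam| * t) / dm.
have K0 : 0 < K by rewrite divr_gt0// ltr_pwDl// mulr_ge0// ltW.
have [phi phiP] := penalty_exists lam K x v (ltW t0).
have phi_lip := penalty_lipschitz (ltW K0) phiP.
have phi_cont : continuous phi by exact: lipschitz_continuous phi_lip.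
have phi_cvx := penalty_convex (ltW K0) phiP.
have [phi_le phi_ex] := phiP.
have lam_s s : 0 <= s <= t -> - (`|lam| * t) <= - lam * s.
  move=> /andP[s0 st]; have := ler_norm lam; have := normr_ge0 lam; nra.
pose C := [set y | `|y - x| <= rho /\ edom f y].
pose G y := fine (f y) + phi y.
have Cx : C x by split; rewrite ?subrr ?normr0 ?ltW.
have G_ge y : C y -> F0 - 1 - `|lam| * t <= G y.
  move=> [/rhoP yrho fy]; rewrite /G.
  have [s st ->] := phi_ex y; have := lam_s s st.
  move: yrho; rewrite -(edom_fineK f_ninfty fy) lte_fin.
  have := mulr_ge0 (ltW K0) (normr_ge0 (y - (x + s *: v))); lra.
(* [M] bounds the norm of the direction [w] below, so the Ekeland term costs at most [h eta] along
   [h w]. *)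
pose M := `|v| + al * rho + 1.
have M0 : 0 < M by rewrite ltr_wpDl// addr_ge0// mulr_ge0// ltW.
pose eps := eta / M.
have eps0 : 0 < eps by rewrite divr_gt0.
have [xt [[xt_rho f_xt] G_xt minG]] := ekeland eps0 Cx
  (fun c => closed_sublevel_addr f_ninfty f_lsc phi_cont) G_ge.
have [s st phi_xt] := phi_ex xt.
set q := xt - (x + s *: v) in phi_xt.
have G_x : G x <= F0.
  have := phi_le x 0; rewrite lexx (ltW t0) scale0r addr0 subrr normr0 !mulr0 addr0.
  by rewrite /G -/F0 => /(_ isT); lra.
have q_dm : `|q| < dm.
  have : K * `|q| < 2 + `|lam| * t.
    have := lam_s s st; have := rhoP xt xt_rho.
    rewrite -(edom_fineK f_ninfty f_xt) lte_fin.
    by move: (le_trans G_xt G_x); rewrite /G phi_xt; lra.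
  rewrite /K mulrAC ltr_pdivrMr// ltr_pM2l//.
  by rewrite ltr_pwDl// mulr_ge0// ltW.
have [q_rho q_d2] : `|q| < rho / 2 /\ `|q| < d2.
  by move: q_dm; rewrite lt_min => /andP.
have /andP[s0 s_le] := st.
have s_lt : s < t.
  rewrite lt_neqAle s_le andbT; apply/eqP => E.
  have := d2P xt; rewrite -E => /(_ q_d2).
  rewrite -(edom_fineK f_ninfty f_xt) lte_fin.
  have := mulr_ge0 (ltW K0) (normr_ge0 q).
  by move: (le_trans G_xt G_x); rewrite /G phi_xt; lra.
have xt_lt : `|xt - x| < rho.
  have -> : xt - x = q + s *: v by rewrite /q opprD addrA subrK.
  apply: le_lt_trans (ler_normD _ _) _; rewrite normrZ (ger0_norm s0).
  by have := normr_ge0 v; nra.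
(* The Ekeland term joins the convex part. As [xt] is interior to the ball, the constrained minimum
   becomes a local minimum of [f + psi]. *)
pose psi y := phi y + eps * `|y - xt|.
have psi_cvx : convex_efun (EFin \o psi).
  move=> y z c c01; rewrite /= -!EFinM -EFinD lee_fin /psi.
  have := phi_cvx y z c c01; move: c01 => /andP[c0 c1].
  have : `|c *: y + (1 - c) *: z - xt| <= c * `|y - xt| + (1 - c) * `|z - xt|.
    have -> : c *: y + (1 - c) *: z - xt = c *: (y - xt) + (1 - c) *: (z - xt).
      by rewrite !scalerBr addrACA -opprD -scalerDl (addrC c) subrK scale1r.
    apply: le_trans (ler_normD _ _) _.
    by rewrite !normrZ (ger0_norm c0) ger0_norm// subr_ge0.
  by move=> /(ler_wpM2l (ltW eps0)); lra.
have psi_lip y z : `|psi y - psi z| <= (K + eps) * `|y - z|.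
  have -> : psi y - psi z = (phi y - phi z) + eps * (`|y - xt| - `|z - xt|).
    by rewrite /psi; ring.
  apply: le_trans (ler_normD _ _) _; rewrite mulrDl lerD// normrM gtr0_norm//.
  rewrite ler_pM2l//; apply: le_trans (ler_dist_dist _ _) _.
  by rewrite opprB addrA subrK.
have min_xt : local_min (fun y => f y + (psi y)%:E)%E xt.
  have nrho : \forall y \near xt, `|y - x| < rho.
    have h : (fun y => `|y - x|) @ xt --> `|xt - x|.
      by apply: cvg_norm; apply: cvgB; [exact: cvg_id|exact: cvg_cst].
    exact: (cvgr_lt _ h).
  rewrite /local_min; apply: filterS nrho => y y_rho.
  have [fy|] := ltP (f y) +oo%E; last first.
    by rewrite leye_eq => /eqP ->; rewrite addye// leey.
  rewrite -(edom_fineK f_ninfty fy) -(edom_fineK f_ninfty f_xt) -!EFinD lee_fin.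
  rewrite /psi subrr normr0 mulr0 addr0 addrA.
  by apply: minG; split => //; exact: ltW.
pose w := v + al *: (x - xt).
have als : al * s <= al * t by rewrite ler_wpM2l.
(* The first bound keeps the shifted parameter in [[0, t]], the second keeps [1 - h al]
   nonnegative. *)
pose h := Num.min (t - s) (1 / (al + 1)).
have h0 : 0 < h by rewrite lt_min subr_gt0 s_lt divr_gt0.
have h_ts : h <= t - s by rewrite ge_min lexx.
have h_al : h * al <= 1.
  have : h <= 1 / (al + 1) by rewrite ge_min lexx orbT.
  by rewrite ler_pdivlMr//; nra.
have w_M : `|w| <= M.
  apply: le_trans (ler_normD _ _) _; rewrite normrZ (ger0_norm al0) distrC /M.
  by have := ler_wpM2l al0 (ltW xt_lt); lra.
(* Taking the parameter [s + h (1 - al s)] at [xt + h w] shrinks the residual [q] to [(1 - h al) q];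
   only the change in [- lam s] and the Ekeland term remain. *)
have psi_w : psi (xt + h *: w) - psi xt <= h * (- lam * (1 - al * s) + eta).
  have s't : 0 <= s + h * (1 - al * s) <= t.
    by have als0 := mulr_ge0 al0 s0; apply/andP; split; nra.
  have := phi_le (xt + h *: w) _ s't.
  have -> : xt + h *: w - (x + (s + h * (1 - al * s)) *: v) = (1 - h * al) *: q.
    have -> : w = (1 - al * s) *: v - al *: q.
      have -> : w = v - al *: (q + s *: v).
        have <- : xt - x = q + s *: v by rewrite /q opprD addrA subrK.
        by rewrite /w -scalerN opprB.
      by rewrite scalerDr opprD scalerA scalerBl scale1r [LHS]addrA addrAC.
    rewrite scalerBr !scalerA [(s + _) *: v]scalerDl [x + (_ + _)]addrA opprD addrACA.
    by rewrite [_ - _ - _]addrAC subrr add0r scalerBl scale1r.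
  rewrite normrZ ger0_norm ?subr_ge0// /psi phi_xt subrr normr0.
  have -> : xt + h *: w - xt = h *: w by rewrite addrAC subrr add0r.
  rewrite normrZ (gtr0_norm h0).
  have : eps * `|w| <= eta.
    by rewrite /eps mulrAC ler_pdivrMr// ler_pM2l.
  move=> /(ler_wpM2l (ltW h0)).
  have : 0 <= h * al * (K * `|q|).
    by rewrite mulr_ge0// mulr_ge0// ltW.
  lra.
have e3 : 0 < Num.min (e / 2) eta by rewrite lt_min eta0 divr_gt0.
have [y [l [Dl y_xt l_w]]] := separation_approx D_subdiff f_ninfty f_lsc psi_cvx
  psi_lip f_xt min_xt h0 psi_w al0 e3.
have [y_e y_eta] : `|y - xt| < e / 2 /\ Num.min (e / 2) eta <= eta.
  by split; [move: y_xt; rewrite lt_min => /andP[]|rewrite ge_min lexx orbT].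
exists y, l; split => //.
  by have := ler_distD xt y x; lra.
have wE : w + al *: (xt - y) = v + al *: (x - y).
  by rewrite /w -addrA -scalerDr addrA subrK.
rewrite wE in l_w.
have : al * s * lam <= al * t * `|lam|.
  apply: (@le_trans _ _ (al * s * `|lam|)).
    by rewrite ler_wpM2l ?ler_norm// mulr_ge0.
  by rewrite ler_wpM2r.
by rewrite /eta in y_eta tallam l_w *; lra.
Unshelve. all: by end_near. Qed.

(** [subdiff_approx] is used with the direction [u + al (a - x)] frozen at [x]; its correction
    [al (x - y)] turns this into the direction attached to [y]. *)
Lemma dir_limsup_subdiff {X : completeNormedModType R} (D : subdiff_op X)
    (f : X -> \bar R) (v a u : X) (al : R) : is_subdifferential D ->
    proper_efun f -> lower_semicontinuous f -> 0 <= al ->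
  dir_limsup f v a (fun x => subdiff_subderiv D f x (u + al *: (a - x))%R) =
  dir_limsup f v a (fun x => radial_subderiv f x (u + al *: (a - x))%R).
Proof.
move=> D_subdiff f_proper f_lsc al0; have [f_ninfty _] := f_proper.
have DC x l : D f x l -> subdiff_C f x l.
  by have [_] := D_subdiff.1 f f_proper f_lsc x; exact.
apply/eqP; rewrite eq_le; apply/andP; split; apply: dir_limsup_le => x r e fx e0.
  move=> /ereal_sup_gt[_ [l Dl <-]]; rewrite lte_fin => rl.
  by have := subdiff_C_approx f_ninfty f_lsc (DC _ _ Dl) al0 e0 rl.
move=> /(subdiff_approx D_subdiff f_ninfty f_lsc fx al0 e0)[y [l [Dl yx rl]]].
exists y; split => //; first by have [] := DC _ _ Dl.
apply: le_ereal_sup_tmp; exists (pairing l (u + al *: (a - y)))%:E; first by exists l.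
rewrite lee_fin; suff <- : u + al *: (a - x) + al *: (x - y) = u + al *: (a - y) by [].
by rewrite -addrA -scalerDr addrA subrK.
Qed.

Lemma inf_dir_limsup_subdiff {X : completeNormedModType R} (D : subdiff_op X)
    (f : X -> \bar R) (v a u : X) : is_subdifferential D ->
    proper_efun f -> lower_semicontinuous f ->
  inf_dir_limsup f (subdiff_subderiv D f) v a u =
  inf_dir_limsup f (radial_subderiv f) v a u.
Proof.
move=> D_subdiff f_proper f_lsc; congr ereal_inf.
by apply: eq_imagel => al /= al0; exact: dir_limsup_subdiff.
Qed.

End subdifferential.

Theorem theorem9 (R : realType) (X : completeNormedModType R)
    (f : X -> \bar R) (xbar u : X) (D : subdiff_op X)
    (f_proper : proper_efun f) (f_lsc : lower_semicontinuous f)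
    (xbar_dom : edom f xbar) (u_neq0 : u != 0)
    (D_subdiff : is_subdifferential D) :
  (radially_accessible f xbar u ->
     (upper_semismooth f xbar u <->
      radial_subderiv f xbar u
        = inf_dir_limsup f (subdiff_subderiv D f) u xbar u)) /\
  (strictly_upper_semismooth f xbar u <->
   radial_subderiv f xbar u
     = inf_dir_limsup f (subdiff_subderiv D f) 0 xbar u).
Proof.
have [f_ninfty _] := f_proper.
rewrite /upper_semismooth /strictly_upper_semismooth !inf_dir_limsup_subdiff//.
(* With [f^D] replaced by [f^r], semismoothness is one inequality between the two sides of the
   equation; only the opposite one remains to be shown. *)
have le_iff (a b : \bar R) : (a <= b)%E -> (b <= a)%E <-> a = b.
  by move=> ab; split=> [ba|->//]; apply/eqP; rewrite eq_le ab.
split=> [acc|]; apply: le_iff; apply: le_ereal_inf_tmp => _ [al /= al0 <-].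
  exact: radial_subderiv_le_dir_limsup.
have := le_dir_limsup_cst
  (fun x => radial_subderiv f x (u + al *: (xbar - x))%R) xbar_dom.
by rewrite /= subrr scaler0 addr0.
Qed.
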